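(* Let $P_n = C_2 \times C_n$ be the Catalan poset on $2n$ elements. Then its sorting probability satisfies $\delta(P_n) = O\bigl(n^{-5/4}\bigr)$ as $n \to \infty$; that is, there exist constants $C>0$ and $N$ such that $\delta(P_n) \le C\, n^{-5/4}$ for all $n \ge N$.
   Context: $C_k$ denotes the chain with $k$ elements, and $P_n=C_2\times C_n$ is the product poset: its elements are the cells $(i,j)$ with $i\in\{1,2\}$, $j\in\{1,\dots,n\}$, ordered by $(i,j)\preceq(i',j')$ iff $i\le i'$ and $j\le j'$. For a finite poset $P=(X,\prec)$, a linear extension is an order-preserving bijection $L: X\to\{1,\dots,|X|\}$; let $\mathcal L_P$ be the set of linear extensions and let $L$ be chosen uniformly at random from $\mathcal L_P$. The sorting probability is $$\delta(P) := \min_{x,y\in X,\ x\ne y} \bigl|\, \mathbf P[L(x)\le L(y)] - \mathbf P[L(y)\le L(x)]\,\bigr|.$$ *)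

(* Defs.v *)
From HB Require Import structures.
From mathcomp Require Import all_boot all_order all_algebra.
From mathcomp Require Import boolp reals exp lra.

Set Implicit Arguments.
Unset Strict Implicit.
Unset Printing Implicit Defensive.

Import Order.TTheory GRing.Theory Num.Theory.
Local Open Scope ring_scope.

(* Ranks are numbered 0, ..., #|T| - 1 rather than 1, ..., #|T|. *)
Definition linear_extensions (d : Order.disp_t) (T : finPOrderType d) :
    {set {ffun T -> 'I_#|T|}} :=
  [set L : {ffun T -> 'I_#|T|} |
    `[< bijective L /\ {homo L : x y / (x <= y)%O} >]].

Definition uniform_prob (R : realType) (S : finType) (A : {set S})
    (E : pred S) : R :=
  #|[set s in A | E s]|%:R / #|A|%:R.

Definition sorting_gap (R : realType) (d : Order.disp_t)
    (T : finPOrderType d) (x y : T) : R :=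
  `| uniform_prob R (linear_extensions T) (fun L => (L x <= L y)%O)
     - uniform_prob R (linear_extensions T) (fun L => (L y <= L x)%O) |.

(* All the terms of the minimum are at most 1, so the neutral element 1 only
   matters when T has fewer than two elements. *)
Definition sorting_probability (R : realType) (d : Order.disp_t)
    (T : finPOrderType d) : R :=
  \big[Num.min/1]_(p : T * T | p.1 != p.2) sorting_gap R p.1 p.2.

Lemma uniform_prob_itv (R : realType) (S : finType) (A : {set S})
    (E : pred S) : 0 <= uniform_prob R A E <= 1.
Proof.
rewrite /uniform_prob divr_ge0 ?ler0n //=.
have [->|A0] := eqVneq #|A| 0%N; first by rewrite invr0 mulr0 ler01.
rewrite ler_pdivrMr ?ltr0n ?lt0n // mul1r ler_nat subset_leq_card //.
by apply/subsetP => s; rewrite inE => /andP[].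
Qed.

Lemma sorting_gap_le1 (R : realType) (d : Order.disp_t)
    (T : finPOrderType d) (x y : T) : sorting_gap R x y <= 1.
Proof.
rewrite /sorting_gap.
set a := uniform_prob _ _ _; set b := uniform_prob _ _ _.
have /andP[a0 a1] : 0 <= a <= 1 by exact: uniform_prob_itv.
have /andP[b0 b1] : 0 <= b <= 1 by exact: uniform_prob_itv.
by rewrite ler_norml; apply/andP; split; lra.
Qed.

Lemma sorting_probability_le (R : realType) (d : Order.disp_t)
    (T : finPOrderType d) (x y : T) :
  x != y -> sorting_probability R T <= sorting_gap R x y.
Proof. by move=> xy; apply: (@bigmin_le_cond _ _ _ _ (x, y)). Qed.

Lemma sorting_probability_attained (R : realType) (d : Order.disp_t)
    (T : finPOrderType d) :
  (1 < #|T|)%N ->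
  exists x y : T, x != y /\ sorting_probability R T = sorting_gap R x y.
Proof.
move=> /card_gt1P[x [y [_ _ xy]]].
rewrite /sorting_probability (@bigmin_eq_arg _ _ _ _ (x, y)) //=; last first.
  by move=> p _; apply: sorting_gap_le1.
by case: arg_minP => //= -[u v] /= uv _; exists u, v.
Qed.

(* The chain C_k is 'I_k, and _ *p _ carries the componentwise order. *)
Definition catalan_poset (n : nat) : finPOrderType _ := ('I_2 *p 'I_n)%type.

Lemma le_catalan_poset (n : nat) (x y : catalan_poset n) :
  (x <= y)%O = ((x.1 <= y.1)%N && (x.2 <= y.2)%N).
Proof. by []. Qed.

Lemma card_catalan_poset (n : nat) : #|catalan_poset n| = (2 * n)%N.
Proof. by rewrite card_prod !card_ord. Qed.

(* Main.v *)
Require Import Defs.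
From mathcomp Require Import all_boot all_order all_algebra.
From mathcomp Require Import boolp reals exp.
From mathcomp Require Import zify ring lra.

Import Order.TTheory GRing.Theory Num.Theory.
Local Open Scope ring_scope.

(* Reading a linear extension row by row turns it into a Dyck path of length
   2n, and L(1,i) < L(2,j) into "the height at time i + j - 1 is at least
   i - j + 1". So the sorting gaps are |2 P(h_t >= a) - 1|, where a path is at
   height h at time t in b(t,h) b(2n-t,h) ways, b being the ballot numbers.

   Near the middle time t = n, the height lives at scale sqrt n, so that
   P(h_n >= a) jumps by O(n^(-1/2)) with a; choose a as the median height.
   Keeping a, and moving t = n + 2k away from the middle, P(h_t >= a)
   decreases, the k-th decrement being of exact order (2k + 1) / n^2: it is the
   net flux of paths through level a, given in closed form by the ratios of the
   ballot numbers. After K = O(n^(3/4)) steps the decrements, of total order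
   K^2 / n^2, have absorbed the jump O(n^(-1/2)), so 1/2 has been crossed, in a
   step of size O(K / n^2) = O(n^(-5/4)). *)

(** * Nonnegative walks and ballot numbers *)

(* Nonnegative +1/-1 walks of length k from g to h. *)
Fixpoint walks (k g h : nat) : nat :=
  if k is k'.+1 then
    (walks k' g.+1 h + (if g is g'.+1 then walks k' g' h else 0))%N
  else g == h.

(* The transfer matrix of the walk commutes with its powers. *)
Lemma walks_last k g h :
  walks k.+1 g h =
  (walks k g h.+1 + (if h is h'.+1 then walks k g h' else 0))%N.
Proof.
elim: k g h => [|k IHk] g h; first by case: g h => [|g] [|h] /=; lia.
rewrite [LHS]/= -/(walks k.+1 _ _) IHk.
case: g => [|g]; first by case: h => [|h] /=; lia.
by rewrite -/(walks k.+1 _ _) IHk; case: h => [|h] /=; lia.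
Qed.

Lemma walks_sym k g h : walks k g h = walks k h g.
Proof.
elim: k g h => [|k IHk] g h; first by rewrite /= eq_sym.
by rewrite walks_last /= (IHk g); case: h => // h; rewrite (IHk g).
Qed.

(** Walks end at 0 instead of starting there, so that the recursion in [h] holds by computation;
    [walks_sym] restores the usual reading. *)
Definition ballot (t h : nat) : nat := walks t h 0.

Lemma ballotS0 t : ballot t.+1 0 = ballot t 1.
Proof. by rewrite /ballot /= addn0. Qed.

Lemma ballotSS t h : ballot t.+1 h.+1 = (ballot t h.+2 + ballot t h)%N.
Proof. by []. Qed.

Lemma ballot_odd t h : odd (t + h) -> ballot t h = 0%N.
Proof.
elim: t h => [|t IHt] [|h] //; rewrite ?ballotS0 ?ballotSS => o.
  by rewrite IHt //; lia.
by rewrite !IHt //; lia.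
Qed.

Lemma ballot_small t h : (t < h)%N -> ballot t h = 0%N.
Proof.
elim: t h => [|t IHt] [|h] // lth.
by rewrite ballotSS !IHt //; lia.
Qed.

Lemma ballot_gt0 t h : (h <= t)%N -> ~~ odd (t + h) -> (0 < ballot t h)%N.
Proof.
elim: t h => [|t IHt] [|h] // le_ht e; rewrite ?ballotS0 ?ballotSS.
  by apply: IHt; lia.
by rewrite addn_gt0 (IHt h) ?orbT //; lia.
Qed.

(** Cut the walk at time [k]; the bound on [M] covers every height reachable by then. *)
Lemma walks_chapman k l g h M : (g + k < M)%N ->
  walks (k + l) g h = (\sum_(0 <= j < M) walks k g j * walks l j h)%N.
Proof.
elim: k g => [|k IHk] g lM.
  rewrite (bigD1_seq g) ?mem_index_iota ?iota_uniq //=; last by lia.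
  rewrite eqxx mul1n big1 ?addn0 // => j /negbTE nj.
  by rewrite eq_sym nj mul0n.
rewrite addSn /= IHk; last by lia.
case: g lM => [|g] lM.
  by rewrite addn0; apply: eq_bigr => j _; rewrite addn0.
rewrite IHk; last by lia.
by rewrite -big_split /=; apply: eq_bigr => j _; rewrite mulnDl.
Qed.

Lemma ballot_convolution k l M : (k < M)%N ->
  (\sum_(0 <= h < M) ballot k h * ballot l h)%N = ballot (k + l) 0.
Proof.
move=> lM; rewrite /ballot (@walks_chapman _ _ _ _ M) ?add0n //.
by apply: eq_bigr => j _; rewrite walks_sym.
Qed.

(** * Ratios of neighbouring ballot numbers *)

Section BallotRatios.
Variable F : realFieldType.
Implicit Types t h : nat.

Local Notation b t h := ((ballot t h)%:R : F).

(** The height ratio is a hypothesis here and in [ballot_down_of] because both are applied at time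
    [t] inside the induction that proves it at time [t.+1]. *)
Lemma ballot_up_of t h :
  b t h.+2 * (h%:R + 1) * (t%:R + h%:R + 4) = (h%:R + 3) * (t%:R - h%:R) * b t h ->
  b t.+1 h.+1 * (h%:R + 1) * (t%:R + h%:R + 4) =
  2 * (h%:R + 2) * (t%:R + 1) * b t h.
Proof. by rewrite ballotSS natrD => E; rewrite !mulrDl E; ring. Qed.

Lemma ballot_down_of t h :
  b t h.+2 * (h%:R + 1) * (t%:R + h%:R + 4) = (h%:R + 3) * (t%:R - h%:R) * b t h ->
  b t.+1 h.+1 * (h%:R + 3) * (t%:R - h%:R) =
  2 * (h%:R + 2) * (t%:R + 1) * b t h.+2.
Proof.
rewrite ballotSS natrD => E.
transitivity (b t h.+2 * (h%:R + 3) * (t%:R - h%:R) +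
  (h%:R + 3) * (t%:R - h%:R) * b t h); first by ring.
by rewrite -E; ring.
Qed.

(* Instead of the closed form (h + 1) / (t + 1) * 'C(t + 1, (t - h) / 2) and its
   parity conditions, only the ratios of ballot numbers are used; in this form
   they hold for all t and h, both sides being 0 when t - h is odd or h > t. *)
Lemma ballot_height_ratio t h :
  b t h.+2 * (h%:R + 1) * (t%:R + h%:R + 4) =
  (h%:R + 3) * (t%:R - h%:R) * b t h.
Proof.
elim: t h => [|t IHt] h.
  rewrite [ballot 0 _.+2]ballot_small // !mul0r.
  by case: h => [|h]; rewrite ?subrr ?mulr0 ?mul0r // [ballot 0 _]ballot_small ?mulr0.
(* Both [b t.+1 h.+2] and [b t.+1 h] get expressed through their common neighbour [b t h.+1]. *)
have U := ballot_up_of _ _ (IHt h.+1).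
apply: (@mulfI _ (h%:R + 2)); first by rewrite -natrD pnatr_eq0 addn2.
have -> : t.+1%:R + h%:R + 4 = t%:R + h.+1%:R + 4 :> F by rewrite -!natr1; ring.
have -> : (h%:R + 2) * (b t.+1 h.+2 * (h%:R + 1) * (t%:R + h.+1%:R + 4)) =
  (h%:R + 1) * (b t.+1 h.+2 * (h.+1%:R + 1) * (t%:R + h.+1%:R + 4)) :> F.
  by rewrite -!natr1; ring.
rewrite U.
case: h U => [|h] U.
  by rewrite ballotS0 -!natr1; ring.
have D := ballot_down_of _ _ (IHt h).
have -> : (h.+1%:R + 2) * ((h.+1%:R + 3) * (t.+1%:R - h.+1%:R) * b t.+1 h.+1) =
  (h%:R + 4) * (b t.+1 h.+1 * (h%:R + 3) * (t%:R - h%:R)) :> F.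
  by rewrite -!natr1; ring.
by rewrite D -!natr1; ring.
Qed.

Lemma ballot_up t h :
  b t.+1 h.+1 * (h%:R + 1) * (t%:R + h%:R + 4) =
  2 * (h%:R + 2) * (t%:R + 1) * b t h.
Proof. exact/ballot_up_of/ballot_height_ratio. Qed.

(** Go from [(t, h)] up to [(t.+1, h.+1)], then down to [(t.+2, h)], and multiply the two ratios. *)
Lemma ballot_time_ratio t h :
  b t.+2 h * ((t%:R + 3) ^+ 2 - (h%:R + 1) ^+ 2) =
  4 * (t%:R + 1) * (t%:R + 2) * b t h.
Proof.
have D : b t.+2 h * (h%:R + 2) * (t%:R + 2 - h%:R) =
    2 * (h%:R + 1) * (t%:R + 2) * b t.+1 h.+1.
  case: h => [|h]; first by rewrite ballotS0; ring.
  have := ballot_down_of _ _ (ballot_height_ratio t.+1 h).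
  by rewrite -!natr1 => E; lra.
apply: (@mulfI _ (h%:R + 2)); first by rewrite -natrD pnatr_eq0 addn2.
transitivity (b t.+2 h * (h%:R + 2) * (t%:R + 2 - h%:R) * (t%:R + h%:R + 4)).
  by ring.
rewrite D.
transitivity (2 * (t%:R + 2) * (b t.+1 h.+1 * (h%:R + 1) * (t%:R + h%:R + 4))).
  by ring.
by rewrite ballot_up; ring.
Qed.

(** The recurrence of the Catalan numbers: at height 0, [(t + 3) ^+ 2 - 1] factors as
    [(t + 2) * (t + 4)]. *)
Lemma ballot_return_ratio t :
  b t.+2 0 * (t%:R + 4) = 4 * (t%:R + 1) * b t 0.
Proof.
apply: (@mulfI _ (t%:R + 2)); first by rewrite -natrD pnatr_eq0 addn2.
by have := ballot_time_ratio t 0; rewrite /= => E; lra.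
Qed.

End BallotRatios.

(** * Distribution of the height at a given time *)

(* Dyck paths of length t + s at height h at time t: reversing the last s steps
   turns their end into a ballot walk. *)
Definition height_count (t s h : nat) : nat := (ballot t h * ballot s h)%N.

(** The cutoff depends only on [t + s], so tails at different times of paths of one length run over
    the same heights. *)
Definition height_tail (t s a : nat) : nat := (\sum_(a <= h < (t + s).+1) height_count t s h)%N.

Lemma height_count_odd t s h : odd (t + h) -> height_count t s h = 0%N.
Proof. by move=> o; rewrite /height_count ballot_odd. Qed.

Lemma height_count_small t s h : (t < h)%N -> height_count t s h = 0%N.
Proof. by move=> o; rewrite /height_count ballot_small. Qed.

Lemma height_tail0 t s : height_tail t s 0 = ballot (t + s) 0.
Proof. by apply: ballot_convolution; rewrite ltnS leq_addr. Qed.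

Lemma height_tail_small t s a : (t < a)%N -> height_tail t s a = 0%N.
Proof.
move=> lta; rewrite /height_tail big_nat_cond big1 // => h /andP[/andP[le_ah _] _].
by apply: height_count_small; lia.
Qed.

Lemma height_tail_recl t s a : height_tail t s a = (height_count t s a + height_tail t s a.+1)%N.
Proof.
have [lta|le_at] := ltnP t a.
  by rewrite !height_tail_small ?height_count_small //; lia.
by rewrite /height_tail big_ltn //; lia.
Qed.

Lemma height_tail_recl2 t s a : ~~ odd (t + a) ->
  height_tail t s a = (height_count t s a + height_tail t s a.+2)%N.
Proof. by move=> e; rewrite height_tail_recl height_tail_recl (@height_count_odd _ _ a.+1) //; lia. Qed.

Section Tail.
Variable F : realFieldType.
Implicit Types t s h a c : nat.

Local Notation b t h := ((ballot t h)%:R : F).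
Local Notation y t s h := ((height_count t s h)%:R : F).

Lemma ballotr_odd t h : odd (t + h) -> b t h = 0.
Proof. by move/ballot_odd ->. Qed.

(* Each h contributes the increment of a discrete flux, so the sum telescopes. *)
Lemma height_tail_step t s c : ~~ odd (t + c) -> ~~ odd (s + c) ->
  (height_tail t s.+2 c.+2)%:R - (height_tail t.+2 s c.+2)%:R =
  b t c.+2 * b s c - b t c * b s c.+2.
Proof.
move=> et es.
have [lt_tc|le_ct] := ltnP t c.
  by rewrite !height_tail_small ?(@ballot_small t) ?mul0r ?subrr //; lia.
rewrite /height_tail !addnS !addSn !natr_sum -sumrB.
(* A discrete Wronskian of the two ballot sequences; the truncation in [.-2] is harmless since [h]
   is at least [c.+2]. *)
pose e h : F := b t h.-2 * b s h - b t h * b s h.-2.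
have -> : \sum_(c.+2 <= h < (t + s).+3)
    ((height_count t s.+2 h)%:R - (height_count t.+2 s h)%:R : F) =
  \sum_(c.+2 <= h < (t + s).+3) ((e h.+1 + e h.+2) - (e h + e h.+1)).
  apply: eq_big_nat => -[|[|h]] // _.
  rewrite /e /height_count !ballotSS !natrM /=.
  case: h => [|h]; rewrite ?ballotS0 ?ballotSS !natrD; ring.
rewrite (@telescope_sumr _ _ _ (fun h => e h + e h.+1)); last by lia.
(* At the upper end the heights exceed [t]; at the lower end [e c.+3] vanishes by parity, so only
   [- e c.+2] survives. *)
rewrite /e /= !(@ballot_small t (t + s).+1) ?(@ballot_small t (t + s).+2)
  ?(@ballot_small t (t + s).+3) ?(@ballot_small t (t + s).+4); try lia.
rewrite (ballotr_odd t c.+1) ?(ballotr_odd t c.+3); try lia.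
by rewrite !mul0r; ring.
Qed.

(** The height ratios at [t] and [s] turn the flux into a multiple of [t - s], which later becomes
    the factor [2 * k + 1]. *)
Lemma height_tail_step_closed t s c : ~~ odd (t + c) -> ~~ odd (s + c) ->
  ((height_tail t s.+2 c.+2)%:R - (height_tail t.+2 s c.+2)%:R) *
    ((c%:R + 3) * (t%:R - c%:R) * (s%:R - c%:R)) =
  y t s c.+2 * (c%:R + 1) * (2 * (c%:R + 2) * (t%:R - s%:R)) :> F.
Proof.
move=> et es; rewrite height_tail_step // /height_count natrM.
have Et := ballot_height_ratio F t c; have Es := ballot_height_ratio F s c.
transitivity (b t c.+2 * (t%:R - c%:R) * ((c%:R + 3) * (s%:R - c%:R) * b s c)
  - b s c.+2 * (s%:R - c%:R) * ((c%:R + 3) * (t%:R - c%:R) * b t c)); first by ring.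
by rewrite -Et -Es; ring.
Qed.

(** By the height ratio this reduces to [t - h <= t + h + 4]. *)
Lemma ballot_density_decr t h :
  b t h.+2 * (h%:R + 1) <= b t h * (h%:R + 3).
Proof.
have P : (0 : F) < t%:R + h%:R + 4 by rewrite -!natrD ltr0n addn4.
rewrite -(ler_pM2r P) ballot_height_ratio.
have : 0 <= b t h * (h%:R + 3) * h%:R by rewrite !mulr_ge0 ?addr_ge0 ?ler0n.
have : 0 <= b t h * (h%:R + 3) by rewrite !mulr_ge0 ?addr_ge0 ?ler0n.
by nra.
Qed.

Lemma height_count_density_decr t s h :
  y t s h.+2 * (h%:R + 1) ^+ 2 <= y t s h * (h%:R + 3) ^+ 2.
Proof.
have Dt := ballot_density_decr t h; have Ds := ballot_density_decr s h.
rewrite /height_count !natrM.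
have -> : b t h.+2 * b s h.+2 * (h%:R + 1) ^+ 2 =
  (b t h.+2 * (h%:R + 1)) * (b s h.+2 * (h%:R + 1)) by ring.
have -> : b t h * b s h * (h%:R + 3) ^+ 2 =
  (b t h * (h%:R + 3)) * (b s h * (h%:R + 3)) by ring.
by apply: ler_pM; rewrite ?mulr_ge0 ?addr_ge0 ?ler0n.
Qed.

(** The squares [(h + 1) ^+ 2] over [h <= a] of the parity of [a] sum to
    [(a + 1) * (a + 2) * (a + 3) / 6]; hence the constant and the induction in steps of two. *)
Lemma height_count_le_sum t s a :
  y t s a * (a%:R + 2) * (a%:R + 3) <=
  6 * (a%:R + 1) * (\sum_(h < a.+1) height_count t s h)%N%:R.
Proof.
elim/ltn_ind: a => -[_|[_|a IHa]].
- by rewrite big_ord1 /=; lra.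
- rewrite !big_ord_recr big_ord0 /= add0n natrD.
  have : 0 <= y t s 0 by []. 
  by have : 0 <= y t s 1 by []; lra.
have {}IHa := IHa a (ltnW (ltnSn _)).
rewrite 2!big_ord_recr /= !natrD.
have D := height_count_density_decr t s a.
have A0 : (0 : F) <= a%:R by [].
set S := (X in X + _ + _); set y1 := y t s a.+1.
have y1_ge0 : 0 <= y1 by [].
have y2_ge0 : 0 <= y t s a.+2 by [].
move: D IHa y2_ge0; rewrite -/S -[a.+2%:R]natr1 -[a.+1%:R]natr1; set z := y t s a.+2; set w := y t s a.
move=> D IHa z0.
have P : (0 : F) < (a%:R + 1) ^+ 2 by rewrite exprn_gt0 // ltr_wpDl.
have Q : w * (a%:R + 2) * (a%:R + 3) * (a%:R + 3) ^+ 2 <=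
   6 * (a%:R + 1) * S * (a%:R + 3) ^+ 2 by apply: ler_wpM2r IHa; apply: sqr_ge0.
have Q2 : z * (a%:R + 1) ^+ 2 * ((a%:R + 2) * (a%:R + 3)) <=
   w * (a%:R + 3) ^+ 2 * ((a%:R + 2) * (a%:R + 3)).
  by apply: ler_wpM2r D; nra.
have P3 : (0 : F) < (a%:R + 1) * (a%:R + 3) by rewrite mulr_gt0 // ltr_wpDl.
have T : z * (a%:R + 1) * (a%:R + 2) <= 6 * S * (a%:R + 3).
  rewrite -(ler_pM2r P3); lra.
have : 0 <= 6 * y1 * (a%:R + 3) by nra.
lra.
Qed.

(* Since the count over (h + 1)^2 decreases with h, the heights below a carry at
   least a constant times (a + 1) times the count at a. *)
Lemma height_count_peak t s a : y t s a * (a%:R + 1) <= 6 * b (t + s) 0.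
Proof.
have [lta|le_at] := ltnP t a; first by rewrite height_count_small // mul0r mulr_ge0.
have L : (\sum_(h < a.+1) height_count t s h)%N%:R <= b (t + s) 0.
  rewrite -height_tail0 ler_nat /height_tail -(big_mkord xpredT (height_count t s)).
  by rewrite (@big_cat_nat _ _ _ a.+1 0 (t + s).+1) //= ?leq_addr //; lia.
have M := height_count_le_sum t s a; have A0 : (0 : F) <= a%:R by [].
have y0 : 0 <= y t s a by [].
have P : (0 : F) < a%:R + 1 by rewrite ltr_wpDl.
rewrite -(ler_pM2r P).
apply: le_trans (_ : _ <= y t s a * (a%:R + 2) * (a%:R + 3)) _; first by nra.
by apply: le_trans M _; rewrite mulrAC ler_wpM2r ?ler_wpM2l //; lra.
Qed.

End Tail.

(** * The median height at the middle time *)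

Section Median.
Variable F : realFieldType.
Implicit Types t s h a c n k : nat.

Local Notation b t h := ((ballot t h)%:R : F).
Local Notation y t s h := ((height_count t s h)%:R : F).

(** The hypothesis is a rearrangement of [(h + 1) * (n + h + 4) <= (h + 3) * (n - h)], which makes
    the height ratio at least 1. *)
Lemma ballot_incr n h : (h.+2 ^ 2 <= n.+2)%N -> b n h <= b n h.+2.
Proof.
move=> le_hn.
have {}le_hn : (h%:R + 2) ^+ 2 <= n%:R + 2 :> F.
  by move: le_hn; rewrite -(ler_nat F) natrX -[h.+2]addn2 -[n.+2]addn2 !natrD.
have E := ballot_height_ratio F n h.
have h0 : (0 : F) <= h%:R by []. have n0 : (0 : F) <= n%:R by [].
have P : (0 : F) < (h%:R + 1) * (n%:R + h%:R + 4) by nra.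
rewrite -(ler_pM2r P) mulrA mulrA E mulrC mulrC.
have b0 : 0 <= b n h by [].
have Q : (h%:R + 1) * (n%:R + h%:R + 4) <= (h%:R + 3) * (n%:R - h%:R) :> F by nra.
have := ler_wpM2r b0 Q; lra.
Qed.

Lemma ballot_incr_iter n h i : ((h + i.*2) ^ 2 <= n.+2)%N ->
  (ballot n h <= ballot n (h + i.*2))%N.
Proof.
elim: i => [|i IHi] le_n; first by rewrite addn0.
apply: leq_trans (IHi _) _.
  by apply: leq_trans le_n; rewrite leq_exp2r // doubleS; lia.
rewrite doubleS !addnS -(ler_nat F); apply: ballot_incr.
by rewrite doubleS !addnS in le_n.
Qed.

(* As long as the squared ballot numbers increase, the lower block of heights
   is outweighed by its translate above it. *)
Lemma median_lower n a : (a.+1.*2 ^ 2 <= n.+2)%N ->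
  (ballot (n + n) 0 <= 2 * height_tail n n a.+1)%N.
Proof.
move=> le_an.
have le_a1n : (a.+1 <= n)%N by nia.
(* The shift is even, to keep parity, and exceeds [a], to make the blocks disjoint; shifted heights
   stay at most [a.+1.*2]. *)
pose s := (a./2.+1).*2.
have [lt_as le_sa] : (a < s)%N /\ (s <= a.+2)%N by rewrite /s; lia.
have D : ballot (n + n) 0 = (\sum_(0 <= h < a.+1) height_count n n h + height_tail n n a.+1)%N.
  by rewrite -height_tail0 /height_tail (@big_cat_nat _ _ _ a.+1 0) //=; lia.
suff : (\sum_(0 <= h < a.+1) height_count n n h <= height_tail n n a.+1)%N by lia.
apply: leq_trans (_ : _ <= \sum_(0 <= h < a.+1) height_count n n (h + s))%N _.
  rewrite big_nat_cond [leqRHS]big_nat_cond; apply: leq_sum => h /andP[/andP[_ lt_ha] _].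
  rewrite /height_count; apply: leq_mul; apply: ballot_incr_iter; apply: leq_trans le_an;
    rewrite leq_exp2r // -/s; lia.
have -> : (\sum_(0 <= h < a.+1) height_count n n (h + s) = \sum_(s <= h < s + a.+1) height_count n n h)%N.
  by rewrite -{2}[s]add0n big_addn addKn.
rewrite /height_tail (@big_cat_nat _ _ _ s a.+1) //=; try lia.
by rewrite (@big_cat_nat _ _ _ (s + a.+1) s (n + n).+1) /=; lia.
Qed.

(* Comparing the paths of length 2n and 2n + 2 through the ratio
   b(n+2,h) / b(n,h), which increases with h, bounds E[(h_n + 1)^2]. *)
Lemma second_moment n : (20 <= n)%N ->
  \sum_(0 <= h < (n + n).+1) y n n h * (h%:R + 1) ^+ 2 <=
  2 * n%:R * b (n + n) 0.
Proof.
move=> n20; have {}n20 : 20 <= n%:R :> F by rewrite (ler_nat F 20).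
set V := \sum_(_ <= h < _) _; set cat := b _ 0.
pose u : F := (n%:R + 3) ^+ 2.
pose kap : F := 4 * (n%:R + 1) * (n%:R + 2).
have C : \sum_(0 <= h < (n + n).+1) y n n h = cat.
  by rewrite -natr_sum ballot_convolution // ltnS leq_addr.
have C' : \sum_(0 <= h < (n + n).+1) b n h * b n.+2 h = b (n + n).+2 0.
  have -> : (n + n).+2 = (n + n.+2)%N by lia.
  rewrite -(@ballot_convolution n n.+2 (n + n).+1) ?ltnS ?leq_addr //.
  by rewrite natr_sum; apply: eq_bigr => h _; rewrite natrM.
(* With [v = (h + 1) ^+ 2] the time ratio is [kap / (u - v)], so termwise this is
   [(u + v) * (u - v) <= u ^+ 2]. *)
have M : kap * (u * cat + V) <= u ^+ 2 * b (n + n).+2 0.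
  rewrite -C -C' !mulr_sumr -big_split mulr_sumr /=.
  apply: ler_sum => h _; rewrite /height_count natrM.
  have E := ballot_time_ratio F n h.
  have bb0 : 0 <= b n h * b n.+2 h * (h%:R + 1) ^+ 4.
    by apply: mulr_ge0; [exact: mulr_ge0 | apply/exprn_ge0/addr_ge0].
  have -> : kap * (u * (b n h * b n h) + b n h * b n h * (h%:R + 1) ^+ 2) =
     b n h * (u + (h%:R + 1) ^+ 2) * (kap * b n h) by ring.
  rewrite /kap -E -/u; lra.
have R : b (n + n).+2 0 * (2 * n%:R + 4) = 4 * (2 * n%:R + 1) * cat.
  by have := ballot_return_ratio F (n + n); rewrite natrD -/cat => E; lra.
have P : 0 < kap * (2 * n%:R + 4) by rewrite /kap; nra.
have Q0 : 0 <= cat by [].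
(* The bound obtained on the second moment is asymptotically [3 * n / 2]; the slack up to [2 * n]
   absorbs the lower-order terms once [n] is at least 20. *)
have L : u ^+ 2 * (4 * (2 * n%:R + 1)) <= kap * (2 * n%:R + 4) * (u + 2 * n%:R).
  rewrite /u /kap; move: n20; set x : F := n%:R => x20.
  have x0 : 0 <= x by lra.
  have m1 : 0 <= x * (x - 20) by rewrite mulr_ge0 ?subr_ge0.
  have m2 : 0 <= x * (x * (x - 20)) by rewrite mulr_ge0.
  have m3 : 0 <= x * (x * (x * (x - 20))) by rewrite mulr_ge0.
  lra.
rewrite -(ler_pM2l P).
have := ler_wpM2r Q0 L.
have N4 : 0 <= 2 * n%:R + 4 :> F by lra.
have := ler_wpM2r N4 M.
have -> : u ^+ 2 * b (n + n).+2 0 * (2 * n%:R + 4) =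
  u ^+ 2 * (4 * (2 * n%:R + 1)) * cat by rewrite -mulrA R; ring.
lra.
Qed.

(** Markov's inequality for [(h + 1) ^+ 2], whose mean is at most [2 * n]. *)
Lemma median_upper n a : (20 <= n)%N ->
  (ballot (n + n) 0 <= 2 * height_tail n n a)%N -> (a.+1 ^ 2 <= 4 * n)%N.
Proof.
move=> n20 half.
have V := second_moment n n20.
rewrite -(ler_nat F) natrX natrM -natr1.
have cat_gt0 : 0 < b (n + n) 0 by rewrite ltr0n ballot_gt0 // addn0 addnn odd_double.
have [lt|le] := ltnP (n + n).+1 a.
  by move: half; rewrite height_tail_small ?muln0 //; [rewrite -(ler_nat F); lra | lia].
have M : (a%:R + 1) ^+ 2 * (height_tail n n a)%:R <=
    \sum_(0 <= h < (n + n).+1) y n n h * (h%:R + 1) ^+ 2.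
  rewrite (@big_cat_nat _ _ _ a 0) //= -[leLHS]add0r lerD //.
    by apply: sumr_ge0 => h _; rewrite mulr_ge0 // sqr_ge0.
  rewrite /height_tail natr_sum mulr_sumr [leLHS]big_nat_cond [leRHS]big_nat_cond.
  apply: ler_sum => h /andP[/andP[le_ah _] _]; rewrite mulrC ler_wpM2l //.
  by rewrite lerXn2r ?nnegrE ?addr_ge0 // lerD2r ler_nat.
have {}half : b (n + n) 0 <= 2 * (height_tail n n a)%:R.
  by rewrite -natrM ler_nat.
have S0 := sqr_ge0 (a%:R + 1 : F).
rewrite -(ler_pM2r cat_gt0).
have := ler_wpM2l S0 half; lra.
Qed.

(** Take the largest [a] of the parity of [n] whose tail is at least one half; [median_lower] and
    [median_upper] bound it on either side. *)
Lemma median_height n : (20 <= n)%N -> exists a,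
  [/\ ~~ odd (n + a), (ballot (n + n) 0 <= 2 * height_tail n n a)%N,
      (2 * height_tail n n a.+2 < ballot (n + n) 0)%N,
      (n < 4 * a.+1 ^ 2)%N & (a.+1 ^ 2 <= 4 * n)%N].
Proof.
move=> n20.
have cat_gt0 : (0 < ballot (n + n) 0)%N.
  by rewrite ballot_gt0 // addn0 addnn odd_double.
pose Q a := ~~ odd (n + a) && (ballot (n + n) 0 <= 2 * height_tail n n a)%N.
have Q0 : Q (odd n).
  rewrite /Q oddD oddb addbb /= mul2n -addnn.
  case: (boolP (odd n)) => [o|_]; rewrite -height_tail0; last by rewrite leq_addr.
  by rewrite [height_tail _ _ 0]height_tail_recl height_count_odd ?addn0 //= leq_addr.
have Qb a : Q a -> (a <= n)%N.
  by case/andP=> _; apply: contraTT; rewrite -ltnNge => lt; rewrite height_tail_small // muln0 -ltnNge.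
case: (ex_maxnP (ex_intro (fun a => is_true (Q a)) _ Q0) Qb) => a /andP[e half] maxa.
have lt_half : (2 * height_tail n n a.+2 < ballot (n + n) 0)%N.
  rewrite ltnNge; apply/negP => h.
  have /maxa : Q a.+2 by rewrite /Q h !addnS /= negbK e.
  by lia.
exists a; split => //; last exact: median_upper.
have : ~~ (a.+1.*2 ^ 2 <= n.+2)%N.
  apply/negP => /median_lower; rewrite height_tail_recl height_count_odd ?add0n; last by lia.
  by lia.
by rewrite -muln2 expnMn; lia.
Qed.

End Median.

(** * Crossing one half by moving the time *)

Section Crossing.
Variable F : realFieldType.
Implicit Types t s h a c n k : nat.

Local Notation b t h := ((ballot t h)%:R : F).
Local Notation y t s h := ((height_count t s h)%:R : F).

(** The time ratios give a quotient of at least [(1 - 3 / n) * (1 - 16 / n)]; the 16 comes from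
    [a.+1 ^ 2 <= 4 * n] and [n <= 2 * s]. *)
Lemma height_count_time_ratio n t s a : (19 <= n)%N -> (n <= t)%N -> (n <= 2 * s)%N ->
  (a.+1 ^ 2 <= 4 * n)%N ->
  (n%:R - 19) * y t s.+2 a <= n%:R * y t.+2 s a.
Proof.
rewrite -(ler_nat F) -(ler_nat F n t) -(ler_nat F n (2 * s)%N) -(ler_nat F (_ ^ _)%N).
rewrite natrX !natrM -[a.+1%:R]natr1 => n19 le_nt le_ns le_an.
have Et := ballot_time_ratio F t a; have Es := ballot_time_ratio F s a.
have t0 : (0 : F) <= t%:R by []. have s0 : (0 : F) <= s%:R by [].
have z0 : 0 <= b t.+2 a * b s.+2 a by rewrite mulr_ge0.
move: Et Es z0 le_an; set v := (a%:R + 1) ^+ 2.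
move: n19 le_nt le_ns t0 s0.
set bt := b t a; set bt2 := b t.+2 a; set bs := b s a; set bs2 := b s.+2 a.
set x : F := n%:R; set T : F := t%:R; set S : F := s%:R.
move=> n19 le_nt le_ns t0 s0 Et Es z0 le_v.
have v0 : 0 <= v by exact: sqr_ge0.
pose A := (T + 1) * (T + 2); pose B := (S + 1) * (S + 2).
have A0 : 0 < A by rewrite /A mulr_gt0 //; lra.
have B0 : 0 < B by rewrite /B mulr_gt0 //; lra.
have H1 : (x - 3) * (T + 3) ^+ 2 <= x * A by rewrite /A; nra.
have H2 : (x - 16) * B <= x * ((S + 3) ^+ 2 - v) by rewrite /B; nra.
have H3 : x * ((x - 19) * (B * (T + 3) ^+ 2)) <=
    x * (x * (A * ((S + 3) ^+ 2 - v))).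
  have H4 : (x - 3) * (T + 3) ^+ 2 * ((x - 16) * B) <= x * A * (x * ((S + 3) ^+ 2 - v)).
    apply: ler_pM => //; first by rewrite mulr_ge0 ?sqr_ge0 //; lra.
    by rewrite mulr_ge0 //; lra.
  have : 0 <= (T + 3) ^+ 2 * B by rewrite mulr_ge0 ?sqr_ge0 // ltW.
  lra.
have x0 : 0 < x by lra.
rewrite (ler_pM2l x0) in H3.
have AB : 0 < 4 * A * (4 * B) by apply: mulr_gt0; apply: mulr_gt0.
rewrite -(ler_pM2r AB).
have -> : x * (bt2 * bs) * (4 * A * (4 * B)) =
    4 * x * A * bt2 * (4 * (S + 1) * (S + 2) * bs) by rewrite /B; ring.
have -> : (x - 19) * (bt * bs2) * (4 * A * (4 * B)) =
   4 * (x - 19) * B * bs2 * (4 * (T + 1) * (T + 2) * bt) by rewrite /A; ring.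
rewrite -Et -Es.
have := ler_wpM2l z0 H3.
have x19 : 0 <= x - 19 by lra.
have := mulr_ge0 (mulr_ge0 (mulr_ge0 x19 (ltW B0)) v0) z0.
lra.
Qed.

Lemma height_count_start_ratio s a : (4 <= s)%N -> (a.+1 ^ 2 <= 4 * s.+2)%N ->
  y s.+2 s.+2 a <= 8 * y s.+2 s a.
Proof.
move=> s4 le_a; rewrite /height_count !natrM mulrCA ler_wpM2l //.
move: s4 le_a; rewrite -(ler_nat F) -(ler_nat F (_ ^ _)%N).
rewrite natrX natrM -[a.+1%:R]natr1 -[s.+2%:R]natr1 -[s.+1%:R]natr1 => s4 le_a.
have E := ballot_time_ratio F s a.
have b0 : 0 <= b s.+2 a by []. have b1 : 0 <= b s a by [].
have P : (0 : F) < (s%:R + 3) ^+ 2 by rewrite exprn_gt0 // ltr_wpDl.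
rewrite -(ler_pM2r P).
have Q : (s%:R + 3) ^+ 2 <= 2 * ((s%:R + 3) ^+ 2 - (a%:R + 1) ^+ 2) :> F by nra.
have Q2 : 4 * (s%:R + 1) * (s%:R + 2) <= 4 * (s%:R + 3) ^+ 2 :> F by nra.
have := ler_wpM2l b0 Q; have := ler_wpM2l b1 Q2; lra.
Qed.

(** The first change of length costs a factor 8. Then [k] factors [1 - 19 / n] leave at least one
    half, by Bernoulli's inequality. *)
Lemma height_count_plateau n a k : (38 <= n)%N -> (38 * k <= n)%N ->
  (a.+1 ^ 2 <= 4 * n)%N ->
  y n n a <= 16 * y (n + k.*2) (n - k.+1.*2) a.
Proof.
move=> n38 le_kn le_an.
have base : y n n a <= 8 * y n (n - 2) a.
  by have := @height_count_start_ratio (n - 2) a; rewrite -(addn2 (n - 2)) subnK; [apply; lia | lia].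
have ind j : (4 * j + 4 <= n)%N ->
  (n%:R - 19 * j%:R) * y n (n - 2) a <= n%:R * y (n + j.*2) (n - j.+1.*2) a.
  elim: j => [_|j IHj le_jn]; first by rewrite mulr0 subr0 addn0.
  have {}IHj := IHj ltac:(lia).
  have := @height_count_time_ratio n (n + j.*2) (n - j.+2.*2) a
    ltac:(lia) (leq_addr _ _) ltac:(lia) le_an.
  have -> : (n - j.+2.*2).+2 = (n - j.+1.*2)%N by lia.
  have -> : (n + j.*2).+2 = (n + j.+1.*2)%N by lia.
  move: IHj; set x0 := y n _ a; set xj := y _ (n - j.+1.*2) a.
  set xk := y _ (n - j.+2.*2) a => IHj step.
  have n19 : (19 : F) <= n%:R by rewrite (ler_nat F 19); lia.
  have n0 : (0 : F) < n%:R by lra.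
  rewrite -(ler_pM2l n0) -natr1.
  have P : 0 <= n%:R - 19 :> F by lra.
  have := ler_wpM2l P IHj; have := ler_wpM2l (ltW n0) step.
  have : 0 <= 361 * j%:R * x0 by rewrite !mulr_ge0.
  lra.
have := ind k ltac:(lia).
have : 38 * k%:R <= n%:R :> F by rewrite -natrM ler_nat.
have : (38 : F) <= n%:R by rewrite (ler_nat F 38).
have : 0 <= y n (n - 2) a by [].
move: base; set x0 := y n (n - 2) a; set xk := y _ (n - k.+1.*2) a.
move=> base x00 n0 le_k ix.
have : 2^-1 * n%:R * x0 <= n%:R * xk by nra.
have np : (0 : F) < n%:R by lra.
rewrite mulrAC mulrC ler_pM2l // => h; lra.
Qed.

Lemma height_tail_step_at n c k : (k.+1.*2 <= n)%N -> ~~ odd (n + c) ->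
  ((height_tail (n + k.*2) (n - k.*2) c.+2)%:R -
     (height_tail (n + k.+1.*2) (n - k.+1.*2) c.+2)%:R) *
    ((c%:R + 3) * (n%:R + 2 * k%:R - c%:R) * (n%:R - 2 * k%:R - 2 - c%:R)) =
  y (n + k.*2) (n - k.+1.*2) c.+2 * (c%:R + 1) *
    (4 * (c%:R + 2) * (2 * k%:R + 1)) :> F.
Proof.
move=> le_kn e.
have := @height_tail_step_closed F (n + k.*2) (n - k.+1.*2) c ltac:(lia) ltac:(lia).
have -> : (n - k.+1.*2).+2 = (n - k.*2)%N by lia.
have -> : (n + k.*2).+2 = (n + k.+1.*2)%N by lia.
have -> : (n + k.*2)%:R = n%:R + 2 * k%:R :> F by rewrite -mul2n natrD natrM.
have -> : (n - k.+1.*2)%:R = n%:R - 2 * k%:R - 2 :> F.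
  by rewrite natrB // -mul2n natrM -natr1; ring.
by move->; ring.
Qed.

(** The constant is [16 * 3 / 4]: 16 from the plateau, 3 from [c + 3 <= 3 * (c + 1)], and 4 from the
    closed form. *)
Lemma step_lower n c k : (38 <= n)%N -> (38 * k <= n)%N -> ~~ odd (n + c) ->
  (c.+3 ^ 2 <= 4 * n)%N ->
  y n n c.+2 * (c%:R + 2) * (2 * k%:R + 1) <=
  12 * n%:R ^+ 2 * ((height_tail (n + k.*2) (n - k.*2) c.+2)%:R -
     (height_tail (n + k.+1.*2) (n - k.+1.*2) c.+2)%:R).
Proof.
move=> n38 le_kn e le_cn.
have le_k2n : (k.+1.*2 <= n)%N by lia.
have plat := @height_count_plateau n c.+2 k n38 le_kn le_cn.
have E := height_tail_step_at n c k le_k2n e.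
have le_cn2 : (4 * c <= 3 * n)%N by nia.
have f1 : 4 * c%:R <= 3 * n%:R :> F by rewrite -!natrM ler_nat.
have f2 : 38 * k%:R <= n%:R :> F by rewrite -natrM ler_nat.
have f3 : (38 : F) <= n%:R by rewrite (ler_nat F 38).
have c0 : (0 : F) <= c%:R by []. have k0 : (0 : F) <= k%:R by [].
move: plat E; set d := _%:R - _%:R; set x := y (n + _) _ _; set x0 := y n n _.
have x_ge0 : 0 <= x by []. have x0_ge0 : 0 <= x0 by [].
move=> plat E.
set N : F := n%:R in f1 f2 f3 E *; set K : F := k%:R in f2 k0 E *.
set C : F := c%:R in f1 c0 E *.
have W0 : 0 < (N + 2 * K - C) * (N - 2 * K - 2 - C) by rewrite mulr_gt0 //; lra.
have W1 : (N + 2 * K - C) * (N - 2 * K - 2 - C) <= N ^+ 2 by nra.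
set W := (N + 2 * K - C) * _ in W0 W1.
have C1 : 0 < C + 1 by lra.
have C3 : 0 < C + 3 by lra.
have {}E : d * W * (C + 3) = (C + 1) * (4 * x * ((C + 2) * (2 * K + 1))).
  by rewrite -[LHS]mulrA -/W [W * _]mulrC /W [(C + 3) * _]mulrA E; ring.
have r0 : 0 <= x * ((C + 2) * (2 * K + 1)) by rewrite !mulr_ge0 //; lra.
have d0 : 0 <= d.
  have : 0 <= d * W * (C + 3) by rewrite E; apply: mulr_ge0; lra.
  by rewrite (pmulr_lge0 _ C3) (pmulr_lge0 _ W0).
have G1 : 4 * (x * ((C + 2) * (2 * K + 1))) <= 3 * (d * W).
  rewrite -(ler_pM2l C1).
  have := mulr_ge0 (mulr_ge0 d0 (ltW W0)) c0.
  lra.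
have G2 : d * W <= d * N ^+ 2 by rewrite ler_wpM2l.
have G3 : x0 * ((C + 2) * (2 * K + 1)) <= 16 * x * ((C + 2) * (2 * K + 1)).
  by rewrite ler_wpM2r // mulr_ge0 //; lra.
lra.
Qed.

(** The closed form gives a factor 4, the peak bound 6, and the product of the two factors linear in
    [n] is at least [n ^+ 2 / 4]; then [96 * (2 * k + 1) <= 192 * (k + 1)]. *)
Lemma step_upper n c k : (100 <= n)%N -> (38 * k <= n)%N -> ~~ odd (n + c) ->
  (c.+3 ^ 2 <= 4 * n)%N ->
  n%:R ^+ 2 * ((height_tail (n + k.*2) (n - k.*2) c.+2)%:R -
     (height_tail (n + k.+1.*2) (n - k.+1.*2) c.+2)%:R) <=
  192 * (k%:R + 1) * b (n + n) 0.
Proof.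
move=> n38 le_kn e le_cn.
have le_k2n : (k.+1.*2 <= n)%N by lia.
have E := height_tail_step_at n c k le_k2n e.
have le_cn2 : (4 * c <= n)%N by nia.
have f1 : 4 * c%:R <= n%:R :> F by rewrite -!natrM ler_nat.
have f2 : 38 * k%:R <= n%:R :> F by rewrite -natrM ler_nat.
have f3 : (100 : F) <= n%:R by rewrite (ler_nat F 100).
have c0 : (0 : F) <= c%:R by []. have k0 : (0 : F) <= k%:R by [].
have peak := height_count_peak F (n + k.*2) (n - k.+1.*2) c.+2.
(* The peak bound concerns paths of length [2 * n - 2], of which there are at most as many as of
   length [2 * n]. *)
have cat : b (n + k.*2 + (n - k.+1.*2)) 0 <= b (n + n) 0.
  have := ballot_return_ratio F (n + k.*2 + (n - k.+1.*2)).
  have -> : (n + k.*2 + (n - k.+1.*2)).+2 = (n + n)%N by lia.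
  set T : F := (n + k.*2 + (n - k.+1.*2))%:R => R.
  have T0 : 0 <= T by []. have P : 0 < T + 4 by lra.
  rewrite -(ler_pM2r P) R; set w := b _ 0.
  have : 0 <= w by []. by nra.
move: E peak; set d := _%:R - _%:R; set x := y (n + _) _ _.
have x_ge0 : 0 <= x by [].
rewrite -[c.+2%:R]natr1 -[c.+1%:R]natr1 => E peak.
have {}peak : x * (c%:R + 3) <= 6 * b (n + n) 0 by lra.
move: peak; set ca := b (n + n) 0 => peak.
set N : F := n%:R in f1 f2 f3 E *; set K : F := k%:R in f2 k0 E *.
set C : F := c%:R in f1 c0 E peak *.
have W1 : N ^+ 2 <= 4 * ((N + 2 * K - C) * (N - 2 * K - 2 - C)) by nra.
set W := (N + 2 * K - C) * _ in W1.
have C3 : 0 < C + 3 by lra.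
have {}E : d * W * (C + 3) = x * (C + 1) * (4 * (C + 2) * (2 * K + 1)).
  by rewrite -[LHS]mulrA [W * _]mulrC /W [(C + 3) * _]mulrA E.
have W0 : 0 < W by have := sqr_ge0 N; nra.
have d0 : 0 <= d.
  have : 0 <= d * W * (C + 3) by rewrite E; do !apply: mulr_ge0 => //; lra.
  by rewrite (pmulr_lge0 _ C3) (pmulr_lge0 _ W0).
have G : d * W <= 4 * (2 * K + 1) * (x * (C + 3)).
  rewrite -(ler_pM2r C3) E.
  have K1 : 0 <= 2 * K + 1 by lra.
  have : (C + 1) * (C + 2) <= (C + 3) ^+ 2 by nra.
  have q0 : 0 <= 4 * x * (2 * K + 1) by rewrite !mulr_ge0.
  by move/(ler_wpM2l q0); lra.
have G2 := ler_wpM2l d0 W1.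
have K4 : 0 <= 4 * (2 * K + 1) by lra.
have G3 := ler_wpM2l K4 peak.
have : 0 <= ca by []. 
have : 0 <= K * ca by rewrite mulr_ge0.
lra.
Qed.

(** The first [K] odd numbers sum to [K ^ 2]. *)
Lemma telescoped_lower n c K : (38 <= n)%N -> (38 * K <= n)%N -> ~~ odd (n + c) ->
  (c.+3 ^ 2 <= 4 * n)%N ->
  y n n c.+2 * (c%:R + 2) * K%:R ^+ 2 <=
  12 * n%:R ^+ 2 * ((height_tail n n c.+2)%:R - (height_tail (n + K.*2) (n - K.*2) c.+2)%:R).
Proof.
move=> n38 + e le_cn; elim: K => [_|K IHK le_Kn].
  by rewrite addn0 subn0 subrr expr0n /= !mulr0.
have := IHK ltac:(lia); have := @step_lower n c K n38 ltac:(lia) e le_cn.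
rewrite -natr1; lra.
Qed.

(** [c.+2] is the median height, and [K] is the last index before the tail first drops below one
    half. *)
Lemma crossing n : (100 <= n)%N -> 4 * (12 * 75 ^+ 2 + 3) ^+ 2 <= n%:R :> F ->
  exists c K,
  [/\ ~~ odd (n + c), (c.+2 + K.*2 <= n)%N,
      (n%:R : F) * K%:R ^+ 4 <= 16 * 144 * n%:R ^+ 4,
      (ballot (n + n) 0 <= 2 * height_tail (n + K.*2) (n - K.*2) c.+2)%N &
      n%:R ^+ 2 * (2 * (height_tail (n + K.*2) (n - K.*2) c.+2)%:R - b (n + n) 0) <=
      384 * (K%:R + 1) * b (n + n) 0].
Proof.
move=> n100 nbig.
(* [median_height] speaks of natural numbers only; [rat] is an arbitrary field in which to run its
   proof. *)
have [a [e half lt_half lt_na le_an]] := @median_height rat n ltac:(lia).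
case: a e half lt_half lt_na le_an => [|[|c]] e half lt_half lt_na le_cn; try lia.
have {}e : ~~ odd (n + c) by lia.
have n38 : (38 <= n)%N by lia.
have n0 : (0 : F) < n%:R by rewrite ltr0n; lia.
have lt_nc : n%:R < 4 * (c%:R + 3) ^+ 2 :> F.
  have : n%:R < (4 * c.+3 ^ 2)%N%:R :> F by rewrite ltr_nat.
  by rewrite natrM natrX -[c.+3]addn3 natrD.
have c0 : (0 : F) <= c%:R by [].
(* While the tail is at least one half, its total loss is less than the jump [y n n c.+2] at the
   median, which bounds [K] by [telescoped_lower]. *)
have above K : (38 * K <= n)%N ->
    (ballot (n + n) 0 <= 2 * height_tail (n + K.*2) (n - K.*2) c.+2)%N ->
    (c%:R + 2) * K%:R ^+ 2 <= 12 * n%:R ^+ 2 :> F.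
  move=> le_Kn halfK.
  have L := telescoped_lower n c K n38 le_Kn e le_cn.
  have y0 : 0 <= y n n c.+2 by [].
  have R : (height_tail n n c.+2)%:R - (height_tail (n + K.*2) (n - K.*2) c.+2)%:R < y n n c.+2 :> F.
    rewrite ltrBlDr -natrD ltr_nat height_tail_recl2; last by lia.
    by lia.
  have N0 : 0 < 12 * n%:R ^+ 2 :> F by rewrite mulr_gt0 // exprn_gt0.
  rewrite -(ltr_pM2l N0) in R.
  have RL := le_lt_trans L R.
  have y1 : 0 < y n n c.+2.
    rewrite lt_neqAle y0 andbT eq_sym; apply/negP => /eqP Z.
    by move: RL; rewrite Z !mul0r mulr0 ltxx.
  by rewrite -(ler_pM2l y1) mulrA [leRHS]mulrC ltW.
pose P k := (2 * height_tail (n + k.*2) (n - k.*2) c.+2 < ballot (n + n) 0)%N.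
(* [n %/ 38] is at least [n / 75], so staying above one half would force [c + 2 <= 12 * 75 ^+ 2],
   against the size of [n]. *)
have PK0 : P (n %/ 38)%N.
  rewrite /P ltnNge; apply/negP => /above; set K0 := (n %/ 38)%N.
  have le1 : (38 * K0 <= n)%N by lia.
  have le2 : n%:R <= 75 * K0%:R :> F by rewrite -natrM ler_nat; lia.
  move=> /(_ le1).
  have big : 12 * 75 ^+ 2 < c%:R + 2 :> F.
    rewrite ltNge; apply/negP => le_c.
    have : (c%:R + 3) ^+ 2 <= (12 * 75 ^+ 2 + 3) ^+ 2 :> F by rewrite lerXn2r ?nnegrE; lra.
    lra.
  have K1 : (0 : F) < K0%:R ^+ 2 by rewrite exprn_gt0 // ltr0n; lia.
  have : n%:R ^+ 2 <= (75 * K0%:R) ^+ 2 :> F by rewrite lerXn2r ?nnegrE ?mulr_ge0.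
  rewrite exprMn -(ltr_pM2r K1) in big *; lra.
case: (ex_minnP (ex_intro (fun k => is_true (P k)) _ PK0)) => -[|K] PK minK.
  by move: PK; rewrite /P addn0 subn0; lia.
have halfK : (ballot (n + n) 0 <= 2 * height_tail (n + K.*2) (n - K.*2) c.+2)%N.
  rewrite leqNgt; apply/negP => PK'; have := minK K PK'; lia.
have le_Kn : (38 * K <= n)%N by have := minK _ PK0; lia.
exists c, K; split => //; first by nia.
(* Square the bound of [above] and insert [n <= 16 * (c + 2) ^+ 2]. *)
- have := above K le_Kn halfK; set x : F := n%:R => h.
  have K0 : 0 <= (c%:R + 2) * K%:R ^+ 2 :> F by rewrite mulr_ge0 ?sqr_ge0 //; lra.
  have : ((c%:R + 2) * K%:R ^+ 2) ^+ 2 <= (12 * x ^+ 2) ^+ 2.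
    rewrite lerXn2r ?nnegrE //; apply: mulr_ge0 => //; exact: sqr_ge0.
  have : x <= 16 * (c%:R + 2) ^+ 2 by rewrite /x; nra.
  have K4 : 0 <= K%:R ^+ 4 :> F by rewrite exprn_ge0.
  move/(ler_wpM2r K4); lra.
(* One step later the tail is below one half, so the excess is at most twice one decrement. *)
- have U := step_upper n c K n100 le_Kn e le_cn.
  have {PK} PK : 2 * (height_tail (n + K.+1.*2) (n - K.+1.*2) c.+2)%:R <= b (n + n) 0.
    by rewrite -natrM ler_nat ltnW.
  have n2 : 0 <= n%:R ^+ 2 :> F by rewrite sqr_ge0.
  have := ler_wpM2l n2 PK; lra.
Qed.

End Crossing.

(** * Binary words as walks *)

(* true is a down step; None records a walk that became negative. *)
Fixpoint walk (g : nat) (w : seq bool) : option nat :=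
  match w with
  | [::] => Some g
  | false :: w' => walk g.+1 w'
  | true :: w' => if g is g'.+1 then walk g' w' else None
  end.

Lemma walk_cat g w1 w2 :
  walk g (w1 ++ w2) = obind (fun h => walk h w2) (walk g w1).
Proof. by elim: w1 g => [|[] w1 IHw] g //=; case: g. Qed.

Lemma count_mem_true (w : seq bool) : count_mem true w = count id w.
Proof. by apply: eq_count => -[]. Qed.

Lemma count_mem_false (w : seq bool) : count_mem false w = count negb w.
Proof. by apply: eq_count => -[]. Qed.

Lemma walkP g w h :
  reflect ((forall m, (count id (take m w) <= g + count negb (take m w))%N)
           /\ (h + count id w = g + count negb w)%N)
          (walk g w == Some h).
Proof.
elim: w g => [|x w IHw] g /=.
  apply: (iffP eqP) => [[->]|[_]]; last by rewrite !addn0 => ->.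
  by split.
case: x => /=; last first.
  apply: (iffP (IHw _)) => -[le_w eq_w]; split; try by move: eq_w; lia.
    by case=> [|m] //=; have := le_w m; lia.
  by move=> m; have := le_w m.+1; rewrite /=; lia.
case: g => [|g].
  by constructor=> -[/(_ 1%N)]; rewrite /= take0.
apply: (iffP (IHw _)) => -[le_w eq_w]; split; try by move: eq_w; lia.
  by case=> [|m] //=; have := le_w m; lia.
by move=> m; have := le_w m.+1; rewrite /=; lia.
Qed.

Lemma sum_tupleS k (f : seq bool -> nat) :
  (\sum_(w : k.+1.-tuple bool) f w =
   \sum_(w : k.-tuple bool) f (false :: w) + \sum_(w : k.-tuple bool) f (true :: w))%N.
Proof.
rewrite (reindex (fun p : bool * k.-tuple bool => cons_tuple p.1 p.2)) /=; last first.
  exists (fun w : k.+1.-tuple bool => (thead w, behead_tuple w)) => [[x w] _|w _] /=.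
    by congr (_, _); apply: val_inj.
  by rewrite [RHS]tuple_eta; apply: val_inj.
rewrite -(pair_big xpredT xpredT (fun x (w : k.-tuple bool) => f (x :: w))) /=.
by rewrite big_bool addnC.
Qed.

Lemma sum_tuple0 (f : seq bool -> nat) : (\sum_(w : 0.-tuple bool) f w = f [::])%N.
Proof.
rewrite (big_pred1 [tuple]) // => w /=.
by rewrite (tuple0 w); apply/esym/eqP.
Qed.

Lemma card_walk k g h :
  (\sum_(w : k.-tuple bool) (walk g w == Some h) = walks k g h)%N.
Proof.
elim: k g => [|k IHk] g; first by rewrite (sum_tuple0 (fun w => walk g w == Some h)).
rewrite (sum_tupleS k (fun w => walk g w == Some h)) /= IHk; congr (_ + _)%N.
by case: g => [|g]; rewrite ?IHk // big1.
Qed.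

Definition walk_above (a k g h : nat) (w : seq bool) : bool :=
  if walk g (take k w) is Some j then (a <= j)%N && (walk j (drop k w) == Some h)
  else false.

Lemma card_walk_above a k l g h M : (g + k < M)%N ->
  (\sum_(w : (k + l).-tuple bool) walk_above a k g h w =
   \sum_(a <= j < M) walks k g j * walks l j h)%N.
Proof.
elim: k g => [|k IHk] g lt_gM.
  rewrite addn0 in lt_gM.
  have above0 w : walk_above a 0 g h w = (a <= g)%N && (walk g w == Some h).
    by rewrite /walk_above take0 drop0.
  under [LHS]eq_bigr => w _ do rewrite above0.
  have [le_ag|lt_ga] := leqP a g; last first.
    rewrite big1 // big_nat_cond big1 // => j /andP[/andP[le_aj _] _].
    by rewrite /= (_ : (g == j) = false) //; lia.
  rewrite card_walk (bigD1_seq g) ?mem_index_iota ?iota_uniq ?le_ag //=.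
  rewrite eqxx mul1n big1 ?addn0 // => j /negbTE nj.
  by rewrite eq_sym nj mul0n.
rewrite addSn (sum_tupleS _ (fun w => walk_above a k.+1 g h w)) /walk_above /=.
rewrite -/(walk_above _ _ _ _ _) IHk; last by lia.
case: g lt_gM => [|g] lt_gM.
  by rewrite [X in (_ + X)%N]big1 // addn0; apply: eq_bigr => j _; rewrite addn0.
rewrite [X in (_ + X)%N = _]IHk; last by lia.
by rewrite -big_split /=; apply: eq_bigr => j _; rewrite mulnDl.
Qed.

(** * Positions of the letters of a word *)

Definition positions (r : bool) (w : seq bool) : seq nat :=
  [seq k <- iota 0 (size w) | nth false w k == r].

Lemma size_positions r w : size (positions r w) = count_mem r w.
Proof.
rewrite size_filter -[in RHS](mkseq_nth false w) /mkseq count_map.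
by apply: eq_count => k.
Qed.

Lemma mem_positions r w k :
  (k \in positions r w) = (k < size w)%N && (nth false w k == r).
Proof. by rewrite mem_filter mem_iota andbC. Qed.

Lemma positions_sorted r w : sorted ltn (positions r w).
Proof. by rewrite sorted_filter ?iota_ltn_sorted //; exact: ltn_trans. Qed.

Lemma positions_ltE r w i m : (i < size (positions r w))%N ->
  (nth 0 (positions r w) i < m)%N = (i < count_mem r (take m w))%N.
Proof.
move=> lt_i; have [le_wm|/ltnW le_mw] := leqP (size w) m.
  rewrite take_oversize // -size_positions lt_i.
  by have := mem_nth 0 lt_i; rewrite mem_positions => /andP[/leq_trans ->].
have Sz : count_mem r (take m w) = size [seq k <- iota 0 m | nth false w k == r].
  have -> : take m w = [seq nth false w k | k <- iota 0 m].
    apply: (@eq_from_nth _ false); first by rewrite size_map size_iota size_takel.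
    move=> k; rewrite size_takel // => lt_km.
    by rewrite nth_take // (nth_map 0%N) ?size_iota // nth_iota.
  by rewrite count_map size_filter; apply: eq_count.
have split_iota : iota 0 (size w) = iota 0 m ++ iota m (size w - m).
  by rewrite -{1}(subnKC le_mw) iotaD add0n.
rewrite Sz; move: lt_i; rewrite /positions split_iota filter_cat size_cat nth_cat.
case: (ltnP i (size [seq k <- iota 0 m | _])) => [lt_i _|le_i lt_i].
  by have := mem_nth 0 lt_i; rewrite mem_filter mem_iota => /andP[_ /andP[_]].
apply/negbTE; rewrite -leqNgt.
have lt_i' : (i - size [seq k <- iota 0 m | nth false w k == r] <
   size [seq k <- iota m (size w - m) | nth false w k == r])%N by lia.
by have := mem_nth 0 lt_i'; rewrite mem_filter mem_iota => /andP[_ /andP[]].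
Qed.

Lemma count_bool (w : seq bool) :
  (count_mem false w + count_mem true w = size w)%N.
Proof. by elim: w => //= -[] w; rewrite /=; lia. Qed.

(** A prefix of length [i + j + 1] has either more than [i] letters [false] or more than [j] letters
    [true], never both; so exactly one of the two occurrences lies in it. *)
Lemma positions_cross w i j :
  (i < size (positions false w))%N -> (j < size (positions true w))%N ->
  (nth 0 (positions false w) i < nth 0 (positions true w) j)%N =
  (i < count_mem false (take (i + j).+1 w))%N.
Proof.
move=> lt_i lt_j; set m := (i + j).+1.
have lt_mw : (m <= size w)%N.
  by rewrite -count_bool; move: lt_i lt_j; rewrite !size_positions /m; lia.
have S := count_bool (take m w); rewrite size_takel // in S.
have := positions_ltE false w i m lt_i; have := positions_ltE true w j m lt_j.
rewrite /m in S *; lia.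
Qed.

(** Forward, apply [positions_cross] at time [2 * i + 1]. Conversely, if a prefix has only [i] up
    steps but more down steps, down step [i] precedes up step [i], counting from 0. *)
Lemma ballot_positions n (w : seq bool) : size w = (2 * n)%N ->
  reflect ([/\ size (positions false w) = n, size (positions true w) = n &
     forall i, (i < n)%N ->
       (nth 0 (positions false w) i < nth 0 (positions true w) i)%N])
    (walk 0 w == Some 0%N).
Proof.
move=> sz_w; have S := count_bool w.
apply: (iffP (walkP _ _ _)) => [[le_w]|[szF szT lt_FT]].
  rewrite -count_mem_true -count_mem_false => eq_w.
  have szF : size (positions false w) = n by rewrite size_positions; lia.
  have szT : size (positions true w) = n by rewrite size_positions; lia.
  split=> // i lt_in; rewrite positions_cross ?szF ?szT //.
  have := le_w (i + i).+1; rewrite -count_mem_true -count_mem_false; have := count_bool (take (i + i).+1 w).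
  by rewrite size_takel; lia.
split; last by rewrite -count_mem_true -count_mem_false -!size_positions szF szT.
move=> m; rewrite -count_mem_true -count_mem_false; rewrite leqNgt; apply/negP; rewrite add0n => lt_m.
set i := count_mem false (take m w) in lt_m.
have lt_in : (i < n)%N.
  apply: leq_trans lt_m _; rewrite -szT size_positions -{2}(cat_take_drop m w).
  by rewrite count_cat leq_addr.
have := positions_ltE true w i m; rewrite szT lt_m => /(_ lt_in).
have := positions_ltE false w i m; rewrite szF ltnn => /(_ lt_in).
by have := lt_FT i lt_in; lia.
Qed.

(** With [u] up steps in the prefix the height is [2 * u - t], and [a + t = 2 * (i + 1)]. *)
Lemma walk_above_count t a (w : seq bool) i j :
  (t <= size w)%N -> t = (i + j).+1 -> (a + j = i.+1)%N ->
  walk_above a t 0 0 w =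
  (walk 0 w == Some 0%N) && (i < count_mem false (take t w))%N.
Proof.
move=> le_tw Et Ea; rewrite /walk_above.
have -> : walk 0 w = obind (fun h => walk h (drop t w)) (walk 0 (take t w)).
  by rewrite -walk_cat cat_take_drop.
case E : (walk 0 (take t w)) => [h|] //=.
have /walkP[_] : walk 0 (take t w) == Some h by rewrite E.
rewrite -count_mem_true -count_mem_false.
have := count_bool (take t w); rewrite size_takel // andbC => S1 S2.
congr (_ && _); move: S1 S2.
set u := count_mem false _; set v := count_mem true _; lia.
Qed.

Lemma card_eq_in (S S' : finType) (A : {set S}) (B : {set S'})
    (f : S -> S') (g : S' -> S) :
  {in A, forall x, f x \in B} -> {in B, forall y, g y \in A} ->
  {in A, cancel f g} -> {in B, cancel g f} -> #|A| = #|B|.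
Proof.
move=> fA gB fK gK; apply/eqP; rewrite eqn_leq; apply/andP; split.
  rewrite -(card_in_imset (can_in_inj fK)); apply/subset_leq_card/subsetP.
  by move=> _ /imsetP[x Ax ->]; apply: fA.
rewrite -(card_in_imset (can_in_inj gK)); apply/subset_leq_card/subsetP.
by move=> _ /imsetP[x Ax ->]; apply: gB.
Qed.

(** * The bijection between linear extensions and ballot words *)

Section Words.
Variable n : nat.
Let T := catalan_poset n.
Let N := #|T|.

Definition second_row (x : T) : bool := (0 < x.1)%N.

Definition cell (r : bool) (i : 'I_n) : T := (inord r : 'I_2, i).

Lemma second_row_cell r i : second_row (cell r i) = r.
Proof. by rewrite /second_row /= inordK; case: r. Qed.

Lemma cell_second_row (x : T) : cell (second_row x) x.2 = x.
Proof.
case: x => r i; rewrite /cell /second_row /=; congr (_, _); apply: val_inj.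
by rewrite /= inordK; case: r => -[|[|m]].
Qed.

Lemma le_cell r i r' i' :
  (cell r i <= cell r' i')%O = (r <= r')%N && (i <= i')%N.
Proof. by rewrite le_catalan_poset /= !inordK //; case: r; case: r'. Qed.

Implicit Type L : {ffun T -> 'I_N}.

Lemma linear_extensionP L :
  reflect (injective L /\ {homo L : x y / (x <= y)%O})
          (L \in linear_extensions T).
Proof.
rewrite inE; apply: (iffP (asboolP _)) => -[injL homoL]; split=> //.
  exact: bij_inj.
by apply: inj_card_bij => //; rewrite card_ord.
Qed.

(* The letter at k tells whether the element of rank k lies in the second row. *)
Definition word L : N.-tuple bool := [tuple [exists x, second_row x && (L x == k)] | k < N].

Lemma size_word L : size (word L) = (2 * n)%N.
Proof. by rewrite size_tuple; exact: card_catalan_poset. Qed.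

Lemma nth_word L x : injective L -> nth false (word L) (L x) = second_row x.
Proof.
move=> injL; rewrite -tnth_nth tnth_mktuple.
apply/existsP/idP => [[z /andP[rz /eqP/injL <-]] //|rx].
by exists x; rewrite rx eqxx.
Qed.

(** Both lists are strictly increasing, so comparing their members suffices. *)
Lemma positions_word L r : L \in linear_extensions T ->
  positions r (word L) = [seq val (L (cell r i)) | i <- enum 'I_n].
Proof.
case/linear_extensionP => injL homoL.
have bijL : bijective L by apply: inj_card_bij => //; rewrite card_ord.
apply: (irr_sorted_eq ltn_trans ltnn); first exact: positions_sorted.
  rewrite sorted_map; apply: (@sub_sorted _ (relpre val ltn)).
    move=> i j /= lt_ij; rewrite ltn_neqAle; apply/andP; split.
      apply: contraTneq lt_ij => /val_inj/injL [] ->; by rewrite ltnn.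
    by apply: (homoL (cell r i) (cell r j)); rewrite le_cell leqnn ltnW.
  by rewrite -sorted_map val_enum_ord iota_ltn_sorted.
move=> k; rewrite mem_positions; apply/andP/mapP => [[]|[i _ ->]].
  rewrite size_tuple => lt_kN /eqP nth_k.
  have [L' _ L'K] := bijL; pose x := L' (Ordinal lt_kN).
  have Lx : val (L x) = k by rewrite /x L'K.
  exists x.2; first by rewrite mem_enum.
  by move: nth_k; rewrite -{1}Lx nth_word // => <-; rewrite cell_second_row.
by rewrite size_tuple ltn_ord nth_word ?second_row_cell.
Qed.

Lemma nth_positions_word L r (i : 'I_n) : L \in linear_extensions T ->
  nth 0%N (positions r (word L)) i = L (cell r i).
Proof.
move=> LE; rewrite positions_word // (nth_map i) ?size_enum_ord //.
by rewrite nth_ord_enum.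
Qed.

Lemma word_ballot L : L \in linear_extensions T -> walk 0 (word L) == Some 0%N.
Proof.
move=> LE; apply/(ballot_positions n); first exact: size_word.
split=> [||i lt_in]; try by rewrite positions_word // size_map size_enum_ord.
rewrite !(nth_positions_word _ _ (Ordinal lt_in)) //.
have /linear_extensionP[injL homoL] := LE.
rewrite ltn_neqAle; apply/andP; split.
  by apply/negP => /eqP/val_inj/injL/(congr1 second_row); rewrite !second_row_cell.
by apply: (homoL (cell _ _) (cell _ _)); rewrite le_cell leqnn.
Qed.

(** The default [enum_rank x] only supplies some rank; on ballot words it is never reached, by
    [unwordE]. *)
Definition unword (w : N.-tuple bool) : {ffun T -> 'I_N} :=
  [ffun x => insubd (enum_rank x) (nth 0%N (positions (second_row x) w) x.2)].

Lemma unword_word L : L \in linear_extensions T -> unword (word L) = L.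
Proof.
move=> LE; apply/ffunP => x; apply: val_inj.
rewrite ffunE val_insubd nth_positions_word // cell_second_row.
by rewrite ltn_ord.
Qed.

Section Unword.
Variable w : N.-tuple bool.
Hypothesis ballot_w : walk 0 w == Some 0%N.

Let size_pos r : size (positions r w) = n.
Proof.
have sz_w : size w = (2 * n)%N by rewrite size_tuple; exact: card_catalan_poset.
by have [] := ballot_positions n w sz_w ballot_w; case: r.
Qed.

Let cross i : (i < n)%N ->
  (nth 0 (positions false w) i < nth 0 (positions true w) i)%N.
Proof.
have sz_w : size w = (2 * n)%N by rewrite size_tuple; exact: card_catalan_poset.
by have [] := ballot_positions n w sz_w ballot_w => _ _; apply.
Qed.

Lemma unwordE x : unword w x = nth 0%N (positions (second_row x) w) x.2 :> nat.
Proof.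
rewrite ffunE val_insubd.
have : nth 0%N (positions (second_row x) w) x.2 \in positions (second_row x) w.
  by rewrite mem_nth ?size_pos.
by rewrite mem_positions size_tuple => /andP[->].
Qed.

Lemma nth_unword x : nth false w (unword w x) = second_row x.
Proof.
have : nth 0%N (positions (second_row x) w) x.2 \in positions (second_row x) w.
  by rewrite mem_nth ?size_pos.
by rewrite unwordE mem_positions => /andP[_ /eqP].
Qed.

Lemma unword_inj : injective (unword w).
Proof.
move=> x z E; have Er : second_row x = second_row z by rewrite -!nth_unword E.
have : nth 0%N (positions (second_row x) w) x.2 = nth 0%N (positions (second_row x) w) z.2.
  by rewrite -unwordE E unwordE Er.
have Su : uniq (positions (second_row x) w).
  by apply: (sorted_uniq ltn_trans ltnn); apply: positions_sorted.
move/eqP; rewrite nth_uniq ?size_pos // => /eqP/val_inj E2.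
by rewrite -[x]cell_second_row -[z]cell_second_row Er E2.
Qed.

Lemma unword_linear : unword w \in linear_extensions T.
Proof.
apply/linear_extensionP; split; first exact: unword_inj.
move=> x z; rewrite -[x]cell_second_row -[z]cell_second_row le_cell => /andP[le_r le_i].
suff : (unword w (cell (second_row x) x.2) <= unword w (cell (second_row z) z.2))%N by [].
have mono r : {in [pred i | (i < n)%N] &, {homo nth 0%N (positions r w) : i j / (i <= j)%N}}.
  move=> i j lti ltj; apply: (sorted_leq_nth leq_trans leqnn) => //.
  - by apply: sub_sorted (positions_sorted r w) => a b /ltnW.
  - by rewrite inE size_pos.
  - by rewrite inE size_pos.
rewrite !unwordE !second_row_cell /=.
case: (second_row x) (second_row z) le_r => -[] // _; try by apply: mono => //; rewrite inE.
(* From the first row to the second: move along the first row to column [z.2], then change rows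
   there. *)
apply: leq_trans (ltnW (cross _ (ltn_ord z.2))).
by apply: mono => //; rewrite inE.
Qed.

Lemma word_unword : word (unword w) = w.
Proof.
apply: eq_from_tnth => k.
have [f _ fK] : bijective (unword w).
  by apply: inj_card_bij; [exact: unword_inj | rewrite card_ord].
rewrite -(fK k) !(tnth_nth false) nth_word ?nth_unword //.
exact: unword_inj.
Qed.

End Unword.

Lemma card_linear_extensions_word (E : pred {ffun T -> 'I_N})
    (E' : pred (seq bool)) :
  {in linear_extensions T, forall L, E L = E' (word L)} ->
  #|[set L in linear_extensions T | E L]| =
  (\sum_(w : N.-tuple bool) ((walk 0 w == Some 0%N) && E' w))%N.
Proof.
move=> EE'; rewrite -big_mkcond /= sum1dep_card.
apply: (@card_eq_in _ _ _ _ word unword) => [L|w|L|w]; rewrite inE.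
- by rewrite inE => /andP[LE EL]; rewrite word_ballot // -EE'.
- by case/andP=> Bw Ew; rewrite inE unword_linear // EE' ?unword_linear // word_unword.
- by case/andP=> LE _; rewrite unword_word.
- by case/andP=> Bw _; rewrite word_unword.
Qed.

End Words.

(** * Sorting gaps in terms of height tails *)

Lemma card_catalan_linear_extensions n :
  #|linear_extensions (catalan_poset n)| = ballot (n + n) 0.
Proof.
have -> : linear_extensions (catalan_poset n) =
    [set L in linear_extensions (catalan_poset n) | predT L].
  by apply/setP => L; rewrite [RHS]inE andbT.
rewrite (@card_linear_extensions_word n predT predT) //.
under eq_bigr => w _ do rewrite andbT.
by rewrite card_walk card_catalan_poset mul2n addnn.
Qed.

Lemma sum_high_words N t s a i j :
  N = (t + s)%N -> t = (i + j).+1 -> (a + j = i.+1)%N ->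
  (\sum_(w : N.-tuple bool)
     ((walk 0 w == Some 0%N) && (i < count_mem false (take t w))%N) =
   height_tail t s a)%N.
Proof.
move=> -> Et Ea.
under eq_bigr => w _ do
  rewrite -(@walk_above_count t a w i j) ?size_tuple ?leq_addr //.
rewrite (@card_walk_above a t s 0 0 (t + s).+1) ?add0n ?ltnS ?leq_addr //.
by apply: eq_bigr => h _; rewrite walks_sym.
Qed.

Lemma card_first_before n (i j : 'I_n) t s a :
  (t + s = n + n)%N -> t = (i + j).+1 -> (a + j = i.+1)%N ->
  #|[set L in linear_extensions (catalan_poset n) |
      (L (cell n false i) <= L (cell n true j))%O]| = height_tail t s a.
Proof.
move=> Ets Et Ea; rewrite -(@sum_high_words #|catalan_poset n| t s a i j) //; last first.
  by rewrite card_catalan_poset Ets mul2n addnn.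
apply: (@card_linear_extensions_word n
  (fun L => (L (cell n false i) <= L (cell n true j))%O)
  (fun w => (i < count_mem false (take t w))%N)) => L LE.
rewrite Et -positions_cross; last 2 first.
- by rewrite positions_word // size_map size_enum_ord.
- by rewrite positions_word // size_map size_enum_ord.
rewrite !nth_positions_word // [RHS]ltn_neqAle.
have /linear_extensionP[injL _] := LE.
suff -> : val (L (cell n false i)) != val (L (cell n true j)) by [].
by apply/negP => /eqP/val_inj/injL/(congr1 (@second_row n)); rewrite !second_row_cell.
Qed.

Lemma card_pairwise_order (d : Order.disp_t) (T : finPOrderType d) (x z : T) :
  x != z ->
  (#|[set L in linear_extensions T | (L x <= L z)%O]| +
   #|[set L in linear_extensions T | (L z <= L x)%O]| =
   #|linear_extensions T|)%N.
Proof.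
move=> xz.
rewrite -(cardsID [set L : {ffun T -> 'I_#|T|} | (L x <= L z)%O] (linear_extensions T)).
congr (_ + _)%N; apply: eq_card => L; rewrite !inE // andbC.
case: asboolP => [[/bij_inj injL _]|_]; rewrite ?andbF // !andbT.
rewrite -ltNge lt_neqAle; case: (_ <= _)%O; rewrite ?andbF //= andbT.
by apply/esym; apply: contra xz => /eqP/injL ->.
Qed.

Lemma catalan_sorting_gap (R : realType) n (i j : 'I_n) t s a :
  (t + s = n + n)%N -> t = (i + j).+1 -> (a + j = i.+1)%N ->
  sorting_gap R (cell n false i) (cell n true j) =
  `|(2 * (height_tail t s a)%:R - (ballot (n + n) 0)%:R) / (ballot (n + n) 0)%:R|.
Proof.
move=> Ets Et Ea; rewrite /sorting_gap /uniform_prob.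
have xz : cell n false i != cell n true j.
  by apply/negP => /eqP/(congr1 (@second_row n)); rewrite !second_row_cell.
have := card_pairwise_order _ _ _ _ xz.
rewrite (card_first_before _ _ _ _ _ _ Ets Et Ea) card_catalan_linear_extensions.
by move=> <-; rewrite natrD -mulrBl; congr (`| _ / _ |); ring.
Qed.

Theorem theorem1p1 (R : realType) :
  exists (C : R) (N : nat), 0 < C /\
    forall n : nat, (N <= n)%N ->
      sorting_probability R (catalan_poset n) <= C * n%:R `^ (- (5 / 4)).
Proof.
pose B : R := 4 * (12 * 75 ^+ 2 + 3) ^+ 2.
(* 384 comes from [crossing], and 8 from [K + 1 <= 8 * r ^+ 3] with [r] the fourth root of [n]. *)
exists (384 * 8), (maxn 100 (Num.bound B)); split; first by rewrite mulr_gt0.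
move=> n; rewrite geq_max => /andP[n100 nB].
have B0 : 0 <= B by rewrite /B mulr_ge0 ?sqr_ge0.
have {nB} nB : B <= n%:R.
  by apply/ltW/(lt_le_trans (archi_boundP B0)); rewrite ler_nat.
have [c [K [e le_cKn K4 half gap]]] := crossing R n n100 nB.
(* The solution of [i + j + 1 = n + 2 * K] and [i - j + 1 = c + 2]. *)
pose i0 := ((n + c)./2 + K)%N; pose j0 := (i0 - c.+1)%N.
have lt_i : (i0 < n)%N by rewrite /i0; lia.
have lt_j : (j0 < n)%N by rewrite /j0; lia.
pose i := Ordinal lt_i; pose j := Ordinal lt_j.
have xz : cell n false i != cell n true j.
  by apply/negP => /eqP/(congr1 (@second_row n)); rewrite !second_row_cell.
apply: le_trans (sorting_probability_le R xz) _.
rewrite (@catalan_sorting_gap R n i j (n + K.*2) (n - K.*2) c.+2); first last.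
- by rewrite /= /j0 /i0; lia.
- by rewrite /= /j0 /i0; lia.
- by lia.
have cat0 : (0 : R) < (ballot (n + n) 0)%:R.
  by rewrite ltr0n ballot_gt0 // addn0 addnn odd_double.
move: half gap; rewrite -(ler_nat R) natrM.
set A : R := (height_tail _ _ _)%:R; set M : R := (ballot _ _)%:R in cat0 * => half gap.
rewrite ger0_norm ?divr_ge0 ?subr_ge0 ?(ltW cat0) // ler_pdivrMr //.
have n1 : (1 : R) <= n%:R by rewrite ler1n; lia.
(* In terms of [r] all fractional powers of [n] become natural powers. *)
pose r : R := n%:R `^ (1 / 4).
have r0 : 0 < r by rewrite powR_gt0 // (lt_le_trans ltr01).
have r4 : n%:R = r ^+ 4.
  by rewrite -powR_mulrn ?(ltW r0) // -powRrM mul1r mulVf ?pnatr_eq0 // powRr1.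
have -> : n%:R `^ (- (5 / 4)) = (r ^+ 5)^-1.
  rewrite powRN -powR_mulrn ?(ltW r0) // -powRrM.
  by congr ((_ `^ _)^-1); ring.
have r1 : 1 <= r.
  rewrite leNgt; apply/negP => lt_r1.
  by move: n1; rewrite r4 leNgt exprn_ilt1 ?(ltW r0).
have K0 : (0 : R) <= K%:R by [].
have Kr : K%:R <= 7 * r ^+ 3.
  have p4 : 0 < r ^+ 4 by rewrite exprn_gt0.
  (* The 7 works because [16 * 144 = 2304] is at most [7 ^ 4 = 2401]. *)
  have le4 : K%:R ^+ 4 <= (7 * r ^+ 3) ^+ 4.
    rewrite -(ler_pM2l p4); move: K4; rewrite r4.
    have : 0 <= r ^+ 16 by rewrite exprn_ge0 // ltW.
    lra.
  by move: le4; rewrite ler_pXn2r // nnegrE mulr_ge0 // exprn_ge0 // ltW.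
have r3 : 1 <= r ^+ 3 by rewrite exprn_ege1.
have p8 : 0 < r ^+ 8 by rewrite exprn_gt0.
rewrite -(ler_pM2l p8).
have -> : r ^+ 8 * (384 * 8 * (r ^+ 5)^-1 * M) = 384 * 8 * r ^+ 3 * M.
  by field; rewrite gt_eqF.
have -> : r ^+ 8 = n%:R ^+ 2 by rewrite r4 -exprM.
apply: le_trans gap _; rewrite ler_wpM2r ?(ltW cat0) //; lra.
Qed.
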